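(* Let $\mathbb{C}$ be a pre-exact Mal'tsev category and let $X$ be a centerless object of $\mathbb{C}$ with global support. Then $X$ is projection-coextensive.
   Context: A category is regular if it has finite limits, coequalizers of kernel pairs, and regular epimorphisms are stable under pullback. $X$ has global support if $X\to 1$ is a regular epimorphism. If coequalizers of equivalence relations exist, the effective closure $\overline{E}$ of an equivalence relation $E$ is the kernel equivalence relation of a coequalizer of $E$. A regular category is pre-exact if it admits coequalizers of equivalence relations and $\overline{E_1\cap E_2}=\overline{E_1}\cap\overline{E_2}$ for any two equivalence relations $E_1,E_2$ on the same object. A finitely complete category is Mal'tsev if every reflexive relation in it is an equivalence relation. In a Mal'tsev category, let $R,S$ be equivalence relations on $X$ represented by $(r_1,r_2):R_0\to X\times X$ and $(s_1,s_2):S_0\to X\times X$, and let $R_0\times_X S_0$ be the pullback of $r_2$ and $s_1$ (generalized elements: triples $(x,y,z)$ with $xRy$ and $ySz$). A connector between $R$ and $S$ is a morphism $p:R_0\times_X S_0\to X$ with $x\,S\,p(x,y,z)$ and $p(x,y,z)\,R\,z$, and such that $p(x,y,y)=x$ and $p(y,y,x)=x$ (in generalized elements, whenever defined). If a connector exists, the pair $(R,S)$ is said to be commuting. $\Delta_X$ is the diagonal relation and $\nabla_X=X\times X$ the total relation. An object $X$ in a regular Mal'tsev category is centerless if for any equivalence relation $E$ on $X$, if $(E,\nabla_X)$ is commuting then $E=\Delta_X$. A product projection of $X$ is a morphism $X\to A$ that is one of the two legs of some binary product diagram $A\leftarrow X\to A'$. For a class $\mathcal{M}$ of morphisms, an $\mathcal{M}$-pushout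 is a pushout square whose two morphisms into the pushout object belong to $\mathcal{M}$. $X$ is $\mathcal{M}$-coextensive if every morphism in $\mathcal{M}$ with domain $X$ admits an $\mathcal{M}$-pushout along every product projection of $X$, and for every commutative diagram consisting of a product diagram $A_1\leftarrow X\to A_2$ (top row), a bottom row $B_1\leftarrow Y\to B_2$, and vertical morphisms $A_1\to B_1$, $X\to Y$, $A_2\to B_2$ all in $\mathcal{M}$, the bottom row is a product diagram if and only if both squares are $\mathcal{M}$-pushouts. $X$ is projection-coextensive if it is $\mathcal{M}$-coextensive with $\mathcal{M}$ the class of all product projections. *)

(* Defs.v *)
From Stdlib Require Import FinFun.
Set Implicit Arguments.
Unset Strict Implicit.
Unset Printing Implicit Defensive.

Record category := Category {
  ob :> Type;
  hom : ob -> ob -> Type;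
  idm : forall A, hom A A;
  comp : forall A B C, hom B C -> hom A B -> hom A C;
  comp_idl : forall A B (f : hom A B), comp (idm B) f = f;
  comp_idr : forall A B (f : hom A B), comp f (idm A) = f;
  comp_assoc : forall A B C D (h : hom C D) (g : hom B C) (f : hom A B),
    comp h (comp g f) = comp (comp h g) f
}.

Arguments hom {_} _ _.
Arguments idm {_} A.
Arguments comp {_ _ _ _} _ _.
Arguments comp_idl {_ _ _} f.
Arguments comp_idr {_ _ _} f.
Arguments comp_assoc {_ _ _ _ _} h g f.

Declare Scope cat_scope.
Open Scope cat_scope.
Notation "g ∘ f" := (comp g f) (at level 40, left associativity) : cat_scope.

Record functor (J C : category) := Functor {
  fob :> J -> C;
  fmap : forall i j, hom i j -> hom (fob i) (fob j);
  fmap_id : forall i, fmap (idm i) = idm (fob i);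
  fmap_comp : forall i j k (g : hom j k) (f : hom i j),
    fmap (g ∘ f) = fmap g ∘ fmap f
}.

Definition is_cone (J C : category) (F : functor J C) (L : C)
    (l : forall j, hom L (F j)) : Prop :=
  forall i j (f : hom i j), fmap F f ∘ l i = l j.

Definition is_limit (J C : category) (F : functor J C) (L : C)
    (l : forall j, hom L (F j)) : Prop :=
  is_cone l /\
  forall (Z : C) (z : forall j, hom Z (F j)), is_cone z ->
    exists! u : hom Z L, forall j, l j ∘ u = z j.

Definition finite_category (J : category) : Prop :=
  Finite J /\ forall i j : J, Finite (hom i j).

Definition finitely_complete (C : category) : Prop :=
  forall (J : category) (F : functor J C), finite_category J ->
    exists (L : C) (l : forall j, hom L (F j)), is_limit l.

Section Category.
Variable C : category.
Implicit Types X Y Z T A B P Q : C.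

Definition is_terminal T : Prop :=
  forall Z, exists! u : hom Z T, True.

Definition is_product A B P (p : hom P A) (q : hom P B) : Prop :=
  forall Z (a : hom Z A) (b : hom Z B),
    exists! u : hom Z P, p ∘ u = a /\ q ∘ u = b.

Definition is_pullback A B X P (f : hom A X) (g : hom B X)
    (p : hom P A) (q : hom P B) : Prop :=
  f ∘ p = g ∘ q /\
  forall Z (a : hom Z A) (b : hom Z B), f ∘ a = g ∘ b ->
    exists! u : hom Z P, p ∘ u = a /\ q ∘ u = b.

Definition is_pushout X A B Q (f : hom X A) (g : hom X B)
    (u : hom A Q) (v : hom B Q) : Prop :=
  u ∘ f = v ∘ g /\
  forall Z (a : hom A Z) (b : hom B Z), a ∘ f = b ∘ g ->
    exists! h : hom Q Z, h ∘ u = a /\ h ∘ v = b.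

Definition is_coequalizer X Y Q (f g : hom X Y) (q : hom Y Q) : Prop :=
  q ∘ f = q ∘ g /\
  forall Z (h : hom Y Z), h ∘ f = h ∘ g -> exists! u : hom Q Z, u ∘ q = h.

Definition is_kernel_pair X Y P (f : hom X Y) (p q : hom P X) : Prop :=
  is_pullback f f p q.

Definition regular_epi X Y (f : hom X Y) : Prop :=
  exists Z (g h : hom Z X), is_coequalizer g h f.

Definition regular_category : Prop :=
  finitely_complete C /\
  (forall X Y P (f : hom X Y) (p q : hom P X), is_kernel_pair f p q ->
     exists Q (c : hom X Q), is_coequalizer p q c) /\
  (forall A B X P (f : hom A X) (g : hom B X) (p : hom P A) (q : hom P B),
     is_pullback f g p q -> regular_epi f -> regular_epi q).

Definition global_support X : Prop :=
  exists T (t : hom X T), is_terminal T /\ regular_epi t.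

(* Joint monicity of [(r1, r2)] says that the induced arrow to [X * X] is a
   monomorphism, so a [relation X] represents a subobject of [X * X]. *)
Record relation (X : C) := Relation {
  rob : C;
  r1 : hom rob X;
  r2 : hom rob X;
  rel_mono : forall T (u v : hom T rob),
    r1 ∘ u = r1 ∘ v -> r2 ∘ u = r2 ∘ v -> u = v
}.

(* [x R y] for generalized elements [x, y : T -> X]. *)
Definition related X (R : relation X) T (x y : hom T X) : Prop :=
  exists w : hom T (rob R), r1 R ∘ w = x /\ r2 R ∘ w = y.

Definition reflexive_rel X (R : relation X) : Prop :=
  forall T (x : hom T X), related R x x.

Definition symmetric_rel X (R : relation X) : Prop :=
  forall T (x y : hom T X), related R x y -> related R y x.

Definition transitive_rel X (R : relation X) : Prop :=
  forall T (x y z : hom T X), related R x y -> related R y z -> related R x z.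

Definition equivalence_rel X (R : relation X) : Prop :=
  reflexive_rel R /\ symmetric_rel R /\ transitive_rel R.

(* Inclusion of subobjects: [(r1, r2)] factors through the legs of [S]. *)
Definition rel_le X (R S : relation X) : Prop := related S (r1 R) (r2 R).

(* Equality of the represented subobjects. *)
Definition rel_eq X (R S : relation X) : Prop := rel_le R S /\ rel_le S R.

Definition is_intersection X (R S I : relation X) : Prop :=
  forall T (x y : hom T X), related I x y <-> related R x y /\ related S x y.

Lemma diagonal_mono X T (u v : hom T X) :
  idm X ∘ u = idm X ∘ v -> idm X ∘ u = idm X ∘ v -> u = v.
Proof. intros H _. now rewrite !comp_idl in H. Qed.

Definition diagonal X : relation X := Relation (@diagonal_mono X).

Definition is_total X (N : relation X) : Prop := is_product (r1 N) (r2 N).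

Definition is_effective_closure X (E K : relation X) : Prop :=
  exists Q (q : hom X Q),
    is_coequalizer (r1 E) (r2 E) q /\ is_kernel_pair q (r1 K) (r2 K).

Definition pre_exact : Prop :=
  regular_category /\
  (forall X (E : relation X), equivalence_rel E ->
     exists Q (q : hom X Q), is_coequalizer (r1 E) (r2 E) q) /\
  (forall X (E1 E2 E K1 K2 K : relation X),
     equivalence_rel E1 -> equivalence_rel E2 -> is_intersection E1 E2 E ->
     is_effective_closure E1 K1 -> is_effective_closure E2 K2 ->
     is_effective_closure E K -> is_intersection K1 K2 K).

Definition maltsev : Prop :=
  finitely_complete C /\
  forall X (R : relation X), reflexive_rel R -> equivalence_rel R.

(* [P], with [a : P -> R] and [b : P -> S], is the object of triples
   [(x, y, z)] with [x R y] and [y S z]; for the generic triple,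
   [x = r1 R ∘ a], [y = r2 R ∘ a = r1 S ∘ b] and [z = r2 S ∘ b]. *)
Definition is_connector X (R S : relation X) P (a : hom P (rob R))
    (b : hom P (rob S)) (p : hom P X) : Prop :=
  related S (r1 R ∘ a) p /\
  related R p (r2 S ∘ b) /\
  (forall T (t : hom T P),
     r2 R ∘ a ∘ t = r2 S ∘ b ∘ t -> p ∘ t = r1 R ∘ a ∘ t) /\
  (forall T (t : hom T P),
     r1 R ∘ a ∘ t = r2 R ∘ a ∘ t -> p ∘ t = r2 S ∘ b ∘ t).

Definition commuting X (R S : relation X) : Prop :=
  exists P (a : hom P (rob R)) (b : hom P (rob S)),
    is_pullback (r2 R) (r1 S) a b /\ exists p : hom P X, is_connector a b p.

Definition centerless X : Prop :=
  forall E N : relation X, equivalence_rel E -> is_total N ->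
    commuting E N -> rel_eq E (diagonal X).

Definition product_projection X A (f : hom X A) : Prop :=
  exists A' (f' : hom X A'), is_product f f' \/ is_product f' f.

Definition morphism_class := forall X Y, hom X Y -> Prop.

Definition is_class_pushout (M : morphism_class) X A B Q (f : hom X A)
    (g : hom X B) (u : hom A Q) (v : hom B Q) : Prop :=
  is_pushout f g u v /\ M _ _ u /\ M _ _ v.

Definition coextensive (M : morphism_class) X : Prop :=
  (forall Y A (m : hom X Y) (p : hom X A), M _ _ m -> product_projection p ->
     exists Q (u : hom Y Q) (v : hom A Q), is_class_pushout M m p u v) /\
  (forall A1 A2 Y B1 B2 (p1 : hom X A1) (p2 : hom X A2)
      (q1 : hom Y B1) (q2 : hom Y B2)
      (m : hom X Y) (m1 : hom A1 B1) (m2 : hom A2 B2),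
     is_product p1 p2 ->
     M _ _ m -> M _ _ m1 -> M _ _ m2 ->
     q1 ∘ m = m1 ∘ p1 -> q2 ∘ m = m2 ∘ p2 ->
     (is_product q1 q2 <->
      is_class_pushout M m p1 q1 m1 /\ is_class_pushout M m p2 q2 m2)).

Definition projection_coextensive X : Prop := coextensive product_projection X.

End Category.

(* Main.v *)
(* Let X = A1 x A2 and let m : X -> Y be a product projection with complement n.
   Let F1, F2 be the images on Y of the kernel relations of p1, p2.  They
   commute: (x, z) |-> (m x, m (p1 x, p2 z), m z) covers the object of triples
   y1 F1 y2 F2 y3, and the connector sends this triple to m (p1 z, p2 x).  As
   any two elements of X are linked by the kernel relations of p1 and p2, the
   relation on X given by n u = n u' and (m u, m u') in F1 /\ F2 commutes with
   the total relation.  Since X is centerless, F1 /\ F2 is the diagonal of Y.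
   By pre-exactness the quotients Y -> Q1, Y -> Q2 by F1, F2 are jointly monic,
   and every element of Q1 x Q2 lifts locally to X, so Y = Q1 x Q2.  Moreover
   Qi is the pushout of m along pi.  Coextensivity then follows from uniqueness
   of pushouts. *)

Require Import Defs.
From Stdlib Require Import List IndefiniteDescription.
Set Implicit Arguments.
Unset Strict Implicit.
Unset Printing Implicit Defensive.

(** * Rewriting in composites, and the shapes of finite diagrams *)

Lemma comp_reassoc (C : category) (A B D T : C) (g : hom B D) (f : hom A B)
    (k : hom A D) (w : hom T A) : g ∘ f = k -> g ∘ (f ∘ w) = k ∘ w.
Proof. intros <-. apply comp_assoc. Qed.


(** [None] is the vertex at which both arrows end. In each case the hom-set is [unit] or
    [Empty_set], so the category laws follow by case analysis. *)
Definition cospan_hom (i j : option bool) : Type :=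
  match i, j with
  | Some a, Some b => if Bool.eqb a b then unit else Empty_set
  | None, Some _ => Empty_set
  | _, None => unit
  end.

Definition cospan_comp (i j k : option bool) :
  cospan_hom j k -> cospan_hom i j -> cospan_hom i k.
Proof.
  destruct i as [[]|], j as [[]|], k as [[]|]; simpl; intros g f;
    first [exact tt | now destruct g | now destruct f].
Defined.

Definition cospan_id (i : option bool) : cospan_hom i i :=
  match i with None | Some true | Some false => tt end.

Definition cospan : category.
Proof.
  refine (@Category (option bool) cospan_hom cospan_id cospan_comp _ _ _).
  - intros [[]|] [[]|] []; reflexivity.
  - intros [[]|] [[]|] []; reflexivity.
  - intros [[]|] [[]|] [[]|] [[]|] [] [] []; reflexivity.
Defined.

Lemma cospan_finite : finite_category cospan.
Proof.
  split.
  - exists (None :: Some true :: Some false :: nil).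
    intros [[]|]; simpl; auto.
  - intros [[]|] [[]|]; simpl;
      solve [exists (tt :: nil); intros []; simpl; auto
            | exists nil; intros []].
Qed.

Definition empty_category : category.
Proof.
  unshelve refine (@Category Empty_set (fun _ _ => Empty_set) _ _ _ _ _);
    intros [].
Defined.

(** * Pullbacks, terminal objects and products *)

Section FiniteLimits.
Context (C : category).
Implicit Types A B I P T X Y Z : C.

Definition cospan_ob (A B X : C) (i : option bool) : C :=
  match i with None => X | Some true => A | Some false => B end.

Definition cospan_map (A B X : C) (f : hom A X) (g : hom B X)
    (i j : option bool) :
  cospan_hom i j -> hom (cospan_ob A B X i) (cospan_ob A B X j).
Proof.
  destruct i as [[]|], j as [[]|]; intros [];
    first [exact (idm _) | exact f | exact g].
Defined.

Definition cospan_functor (A B X : C) (f : hom A X) (g : hom B X) :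
  functor cospan C.
Proof.
  refine (@Functor cospan C (cospan_ob A B X) (cospan_map f g) _ _).
  - intros [[]|]; reflexivity.
  - intros [[]|] [[]|] [[]|] [] []; simpl;
      rewrite ?comp_idl, ?comp_idr; reflexivity.
Defined.

Lemma pullback_exists (HC : finitely_complete C) (A B X : C) (f : hom A X)
    (g : hom B X) :
  exists P (p : hom P A) (q : hom P B), is_pullback f g p q.
Proof.
  destruct (HC _ (cospan_functor f g) cospan_finite) as (L & l & Hc & Hl).
  assert (Hf := Hc (Some true) None tt).
  assert (Hg := Hc (Some false) None tt).
  simpl in Hf, Hg.
  exists L, (l (Some true)), (l (Some false)). split.
  - now transitivity (l None).
  - intros Z a b Hab.
    pose (z := fun j : option bool =>
      match j return hom Z (cospan_functor f g j) with
      | None => f ∘ a | Some true => a | Some false => b end).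
    destruct (Hl Z z) as (u & Hu & Huniq).
    + intros [[]|] [[]|] []; simpl; rewrite ?comp_idl; auto.
    + exists u. split.
      * split; [exact (Hu (Some true)) | exact (Hu (Some false))].
      (* A competitor [v] is known on the two outer legs only; the leg at [None] is [f] after the
         leg at [Some true]. *)
      * intros v [Hva Hvb]. apply Huniq. intros [[]|]; auto.
        rewrite <- Hf, <- comp_assoc. simpl. now rewrite Hva.
Qed.

Lemma terminal_exists (HC : finitely_complete C) : exists T : C, is_terminal T.
Proof.
  assert (F : functor empty_category C).
  { unshelve refine (@Functor empty_category C _ _ _ _); intros []. }
  destruct (HC _ F) as (L & l & _ & Hl).
  { split; [exists nil; intros [] | intros []]. }
  exists L. intros Z.
  destruct (Hl Z (fun i => match i with end)) as (u & _ & Huniq).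
  { intros []. }
  exists u. split; auto. intros v _. apply Huniq. intros [].
Qed.

Lemma terminal_eq (T Z : C) (u v : hom Z T) : is_terminal T -> u = v.
Proof.
  intros HT. destruct (HT Z) as (w & _ & Hw).
  now rewrite <- (Hw u I), <- (Hw v I).
Qed.

Lemma product_exists (HC : finitely_complete C) (A B : C) :
  exists P (p : hom P A) (q : hom P B), is_product p q.
Proof.
  destruct (terminal_exists HC) as (T & HT).
  destruct (HT A) as (tA & _). destruct (HT B) as (tB & _).
  destruct (pullback_exists HC tA tB) as (P & p & q & _ & H).
  exists P, p, q. intros Z a b. apply H. now apply terminal_eq.
Qed.

Section Pairing.
Context (A B P : C) (p : hom P A) (q : hom P B) (H : is_product p q).

(** Indefinite description turns the mediating arrow, which [is_product] provides only
    propositionally, into a term that can be composed and rewritten. *)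
Definition pairing Z (a : hom Z A) (b : hom Z B) : hom Z P :=
  proj1_sig (constructive_indefinite_description _ (H a b)).

Lemma fst_pairing Z (a : hom Z A) (b : hom Z B) : p ∘ pairing a b = a.
Proof.
  unfold pairing.
  now destruct constructive_indefinite_description as (u & (? & ?) & ?).
Qed.

Lemma snd_pairing Z (a : hom Z A) (b : hom Z B) : q ∘ pairing a b = b.
Proof.
  unfold pairing.
  now destruct constructive_indefinite_description as (u & (? & ?) & ?).
Qed.

Lemma product_ext Z (u v : hom Z P) : p ∘ u = p ∘ v -> q ∘ u = q ∘ v -> u = v.
Proof.
  intros Hp Hq. destruct (H (p ∘ v) (q ∘ v)) as (w & _ & Hw).
  now rewrite <- (Hw u), <- (Hw v).
Qed.

Lemma pairing_comp Z T (a : hom Z A) (b : hom Z B) (w : hom T Z) :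
  pairing a b ∘ w = pairing (a ∘ w) (b ∘ w).
Proof.
  apply product_ext; rewrite comp_assoc, ?fst_pairing, ?snd_pairing; auto.
Qed.

Lemma is_product_swap : is_product q p.
Proof.
  intros Z b a. destruct (H a b) as (u & [] & Hu). exists u.
  split; [auto | intros v []; auto].
Qed.

End Pairing.

Lemma pullback_ext A B X P (f : hom A X) (g : hom B X) (p : hom P A)
    (q : hom P B) Z (u v : hom Z P) :
  is_pullback f g p q -> p ∘ u = p ∘ v -> q ∘ u = q ∘ v -> u = v.
Proof.
  intros [Hc H] Hp Hq.
  destruct (H Z (p ∘ v) (q ∘ v)) as (w & _ & Hw).
  { now rewrite !comp_assoc, Hc. }
  now rewrite <- (Hw u), <- (Hw v).
Qed.

Lemma pullback_lift A B X P (f : hom A X) (g : hom B X) (p : hom P A)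
    (q : hom P B) Z (a : hom Z A) (b : hom Z B) :
  is_pullback f g p q -> f ∘ a = g ∘ b ->
  exists u : hom Z P, p ∘ u = a /\ q ∘ u = b.
Proof. intros [_ H] Hab. destruct (H Z a b Hab) as (u & Hu & _). eauto. Qed.

Lemma related_refl_at X (R : relation X) T (w : hom T (rob R)) :
  related R (r1 R ∘ w) (r2 R ∘ w).
Proof. now exists w. Qed.

Lemma related_comp X (R : relation X) T T' (x y : hom T X) (c : hom T' T) :
  related R x y -> related R (x ∘ c) (y ∘ c).
Proof.
  intros (w & <- & <-). exists (w ∘ c). now rewrite !comp_assoc.
Qed.

Lemma related_diagonal X T (x y : hom T X) : related (diagonal X) x y <-> x = y.
Proof.
  split.
  - intros (w & <- & <-). reflexivity.
  - intros ->. exists y. simpl. now rewrite comp_idl.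
Qed.

(** * Calculus of relations in generalized elements, and the Mal'tsev condition *)

Section Relations.
Context (HC : finitely_complete C).

(** This is the pullback of [R] along [m × m], described by its generalized elements so that the
    representing object can be forgotten. *)
Lemma relation_preimage X Y (m : hom X Y) (R : relation Y) :
  exists S : relation X, forall T (x y : hom T X),
    related S x y <-> related R (m ∘ x) (m ∘ y).
Proof.
  destruct (product_exists HC X X) as (XX & x1 & x2 & HX).
  destruct (product_exists HC Y Y) as (YY & y1 & y2 & HY).
  destruct (pullback_exists HC (pairing HY (m ∘ x1) (m ∘ x2))
    (pairing HY (r1 R) (r2 R))) as (P & p & q & HP).
  assert (E1 : m ∘ (x1 ∘ p) = r1 R ∘ q).
  { pose proof (f_equal (comp y1) (proj1 HP)) as E. simpl in E.
    now rewrite !comp_assoc, !fst_pairing, <- comp_assoc in E. }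
  assert (E2 : m ∘ (x2 ∘ p) = r2 R ∘ q).
  { pose proof (f_equal (comp y2) (proj1 HP)) as E. simpl in E.
    now rewrite !comp_assoc, !snd_pairing, <- comp_assoc in E. }
  unshelve eexists (@Relation C X P (x1 ∘ p) (x2 ∘ p) _).
  - intros T u v H1 H2. rewrite <- !comp_assoc in H1, H2.
    pose proof (product_ext HX H1 H2) as H.
    apply (pullback_ext HP H). apply (@rel_mono _ _ R).
    + rewrite !comp_assoc, <- E1, <- !comp_assoc. now rewrite H.
    + rewrite !comp_assoc, <- E2, <- !comp_assoc. now rewrite H.
  - intros T x y. split.
    + intros (w & <- & <-). exists (q ∘ w). simpl.
      now rewrite !comp_assoc, <- E1, <- E2, !comp_assoc.
    + intros (w & H1 & H2).
      destruct (pullback_lift (a := pairing HX x y) (b := w) HP)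
        as (u & Hu1 & Hu2).
      { rewrite !pairing_comp, <- !comp_assoc, fst_pairing, snd_pairing.
        now rewrite H1, H2. }
      exists u. simpl. now rewrite <- !comp_assoc, Hu1, fst_pairing, snd_pairing.
Qed.

Lemma intersection_exists X (R S : relation X) : 
  exists K : relation X, is_intersection R S K.
Proof.
  destruct (product_exists HC X X) as (XX & x1 & x2 & HX).
  destruct (pullback_exists HC (pairing HX (r1 R) (r2 R))
    (pairing HX (r1 S) (r2 S))) as (P & p & q & HP).
  assert (E1 : r1 R ∘ p = r1 S ∘ q).
  { pose proof (f_equal (comp x1) (proj1 HP)) as E. simpl in E.
    now rewrite !comp_assoc, !fst_pairing in E. }
  assert (E2 : r2 R ∘ p = r2 S ∘ q).
  { pose proof (f_equal (comp x2) (proj1 HP)) as E. simpl in E.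
    now rewrite !comp_assoc, !snd_pairing in E. }
  unshelve eexists (@Relation C X P (r1 R ∘ p) (r2 R ∘ p) _).
  - intros T u v H1 H2.
    apply (pullback_ext HP).
    + apply (@rel_mono _ _ R); now rewrite !comp_assoc.
    + rewrite E1 in H1. rewrite E2 in H2.
      apply (@rel_mono _ _ S); now rewrite !comp_assoc.
  - intros T x y. split.
    + intros (w & <- & <-). split.
      * exists (p ∘ w). simpl. now rewrite !comp_assoc.
      * exists (q ∘ w). simpl. now rewrite !comp_assoc, E1, E2.
    + intros [(w & H1 & H2) (w' & H1' & H2')].
      destruct (pullback_lift (a := w) (b := w') HP) as (u & Hu1 & Hu2).
      { now rewrite !pairing_comp, H1, H2, H1', H2'. }
      exists u. simpl. now rewrite <- !comp_assoc, Hu1.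
Qed.

Lemma kernel_relation X Y (f : hom X Y) :
  exists K : relation X, is_kernel_pair f (r1 K) (r2 K).
Proof.
  destruct (pullback_exists HC f f) as (P & p & q & HP).
  unshelve eexists (@Relation C X P p q _).
  - intros T u v. apply (pullback_ext HP).
  - exact HP.
Qed.

Lemma related_kernel X Y (f : hom X Y) (K : relation X) T (x y : hom T X) :
  is_kernel_pair f (r1 K) (r2 K) -> (related K x y <-> f ∘ x = f ∘ y).
Proof.
  intros HK. split.
  - intros (w & <- & <-). now rewrite !comp_assoc, (proj1 HK).
  - intros H. destruct (pullback_lift HK H) as (u & Hu). now exists u.
Qed.

(* Apply reflexivity => symmetry to the relation [(a, b) ~ (a', b')] iff
   [a I b'] on the object [I]. *)
Lemma maltsev_difunctional (HM : maltsev C) A B I (i : hom I A) (j : hom I B) :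
  (forall T (u v : hom T I), i ∘ u = i ∘ v -> j ∘ u = j ∘ v -> u = v) ->
  forall T (u v w : hom T I), j ∘ u = j ∘ v -> i ∘ v = i ∘ w ->
    exists t : hom T I, i ∘ t = i ∘ u /\ j ∘ t = j ∘ w.
Proof.
  intros Hmono T u v w Huv Hvw.
  destruct (product_exists HC I I) as (II & s & t & HI).
  destruct (product_exists HC A B) as (AB & a & b & HAB).
  destruct (pullback_exists HC (pairing HAB (i ∘ s) (j ∘ t)) (pairing HAB i j))
    as (P & p & q & HP).
  assert (E1 : i ∘ (s ∘ p) = i ∘ q).
  { pose proof (f_equal (comp a) (proj1 HP)) as E. simpl in E.
    now rewrite !comp_assoc, !fst_pairing, <- comp_assoc in E. }
  assert (E2 : j ∘ (t ∘ p) = j ∘ q).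
  { pose proof (f_equal (comp b) (proj1 HP)) as E. simpl in E.
    now rewrite !comp_assoc, !snd_pairing, <- comp_assoc in E. }
  assert (Hm : forall T (u v : hom T P),
    s ∘ p ∘ u = s ∘ p ∘ v -> t ∘ p ∘ u = t ∘ p ∘ v -> u = v).
  { intros Z u' v' H1 H2.
    pose proof H1 as H1'. pose proof H2 as H2'.
    rewrite <- !comp_assoc in H1, H2. apply (pullback_ext HP).
    - now apply (product_ext HI).
    - apply Hmono; rewrite !comp_assoc, <- ?E1, <- ?E2, <- !comp_assoc;
        now rewrite ?H1, ?H2. }
  pose (R := Relation Hm).
  assert (HR : forall Z (x y : hom Z I),
    related R x y <-> exists k, i ∘ k = i ∘ x /\ j ∘ k = j ∘ y).
  { intros Z x y. split.
    - intros (k & <- & <-). exists (q ∘ k). simpl.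
      now rewrite !comp_assoc, <- E1, <- E2, !comp_assoc.
    - intros (k & H1 & H2).
      destruct (pullback_lift (a := pairing HI x y) (b := k) HP)
        as (l & Hl1 & Hl2).
      { rewrite !pairing_comp, <- !comp_assoc, fst_pairing, snd_pairing.
        now rewrite H1, H2. }
      exists l. simpl.
      now rewrite <- !comp_assoc, Hl1, fst_pairing, snd_pairing. }
  destruct (proj2 HM _ R) as (_ & Hsym & _).
  { intros Z x. apply HR. now exists x. }
  (* The element [v] witnesses that [w] is related to [u]; symmetry reverses this into the required
     [t]. *)
  apply HR, Hsym, HR. exists v. auto.
Qed.

(* Generalized elements [(x, y, y)] and [(y, y, z)] generate the object of
   triples [x R y S z]: apply difunctionality to
   [((x, y), (y, y)), ((y, y), (y, y)), ((y, y), (y, z))]. *)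
Lemma maltsev_triples_generated (HM : maltsev C) X (R S : relation X)
    P (a : hom P (rob R)) (b : hom P (rob S)) I (i : hom I P) :
  reflexive_rel R -> reflexive_rel S -> is_pullback (r2 R) (r1 S) a b ->
  (forall T (u v : hom T I), i ∘ u = i ∘ v -> u = v) ->
  (forall T (t : hom T P), r2 R ∘ a ∘ t = r2 S ∘ b ∘ t ->
     exists w, i ∘ w = t) ->
  (forall T (t : hom T P), r1 R ∘ a ∘ t = r2 R ∘ a ∘ t ->
     exists w, i ∘ w = t) ->
  forall T (t : hom T P), exists w, i ∘ w = t.
Proof.
  intros HR HS HP Hi Hright Hleft T t.
  pose (y := r2 R ∘ (a ∘ t)).
  assert (Ey : r1 S ∘ (b ∘ t) = y).
  { unfold y. now rewrite !comp_assoc, (proj1 HP). }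
  destruct (HR T y) as (ry & Hry1 & Hry2).
  destruct (HS T y) as (sy & Hsy1 & Hsy2).
  destruct (pullback_lift (a := a ∘ t) (b := sy) HP) as (t1 & A1 & B1).
  { now rewrite Hsy1. }
  destruct (pullback_lift (a := ry) (b := sy) HP) as (t2 & A2 & B2).
  { now rewrite Hsy1. }
  destruct (pullback_lift (a := ry) (b := b ∘ t) HP) as (t3 & A3 & B3).
  { now rewrite Hry2. }
  destruct (Hright _ t1) as (w1 & Hw1).
  { now rewrite <- !comp_assoc, A1, B1, Hsy2. }
  destruct (Hright _ t2) as (w2 & Hw2).
  { now rewrite <- !comp_assoc, A2, B2, Hry2, Hsy2. }
  destruct (Hleft _ t3) as (w3 & Hw3).
  { now rewrite <- !comp_assoc, A3, Hry1, Hry2. }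
  (* The legs [a ∘ i] and [b ∘ i] are jointly monic since [i] is mono and [P] is a pullback. The
     resulting [w] joins the first half of [t1] to the second half of [t3], which recovers [t]. *)
  destruct (@maltsev_difunctional HM _ _ _ (a ∘ i) (b ∘ i)) with (T := T)
    (u := w1) (v := w2) (w := w3) as (w & Hwa & Hwb).
  - intros Z u v. rewrite <- !comp_assoc. intros H1 H2.
    apply Hi. exact (pullback_ext HP H1 H2).
  - rewrite <- !comp_assoc, Hw1, Hw2. now rewrite B1, B2.
  - rewrite <- !comp_assoc, Hw2, Hw3. now rewrite A2, A3.
  - exists w. apply (pullback_ext HP).
    + rewrite comp_assoc, Hwa, <- comp_assoc, Hw1. exact A1.
    + rewrite comp_assoc, Hwb, <- comp_assoc, Hw3. exact B3.
Qed.

End Relations.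
End FiniteLimits.

(** * Regular epimorphisms, local lifting and images *)

Section RegularEpi.
Context (C : category).

Lemma regular_epi_epi (X Y Z : C) (f : hom X Y) (u v : hom Y Z) :
  regular_epi f -> u ∘ f = v ∘ f -> u = v.
Proof.
  intros (W & g & h & Hc & Hu) E.
  destruct (Hu Z (v ∘ f)) as (w & _ & Hw).
  { now rewrite <- !comp_assoc, Hc. }
  now rewrite <- (Hw u), <- (Hw v).
Qed.

(** The condition on generalized elements is applied to the parallel pair of which [f] is the
    coequalizer. *)
Lemma regular_epi_factor (X Y Z : C) (f : hom X Y) (k : hom X Z) :
  regular_epi f ->
  (forall T (s t : hom T X), f ∘ s = f ∘ t -> k ∘ s = k ∘ t) ->
  exists l, l ∘ f = k.
Proof.
  intros (W & g & h & Hc & Hu) E.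
  destruct (Hu Z k (E _ _ _ Hc)) as (w & Hw & _). eauto.
Qed.

(** Since [m] is mono, the local lift [w] agrees on any two elements that [c] identifies, hence it
    descends along [c]. *)
Lemma mono_descent (S B T T' : C) (m : hom S B) (c : hom T' T) (y : hom T B)
    (w : hom T' S) :
  (forall Z (u v : hom Z S), m ∘ u = m ∘ v -> u = v) ->
  regular_epi c -> m ∘ w = y ∘ c -> exists v, m ∘ v = y.
Proof.
  intros Hm Hc E. destruct (regular_epi_factor (k := w) Hc) as (v & Hv).
  - intros Z s t Est. apply Hm. now rewrite !comp_assoc, E, <- !comp_assoc, Est.
  - exists v. apply (regular_epi_epi Hc). now rewrite <- comp_assoc, Hv.
Qed.

(** Same descent as for a monomorphism, with joint monicity of the legs of [R]: relations may be
    verified on a cover. *)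
Lemma related_descent (X T T' : C) (R : relation X) (x y : hom T X)
    (c : hom T' T) :
  regular_epi c -> related R (x ∘ c) (y ∘ c) -> related R x y.
Proof.
  intros Hc (w & H1 & H2).
  destruct (regular_epi_factor (k := w) Hc) as (v & Hv).
  - intros Z s t E.
    apply (@rel_mono _ _ R); rewrite !comp_assoc, ?H1, ?H2, <- !comp_assoc;
      now rewrite E.
  - exists v. split; apply (regular_epi_epi Hc); now rewrite <- comp_assoc, Hv.
Qed.

Lemma coequalizer_regular_epi (X Y Q : C) (f g : hom X Y) (q : hom Y Q) :
  is_coequalizer f g q -> regular_epi q.
Proof. intros H. now exists X, f, g. Qed.

Context (HC : regular_category C).

(** A regular epimorphism is surjective on generalized elements up to a cover [c], obtained by
    pulling [f] back along [y]. Later element arguments rest on this. *)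
Lemma local_lift (A B T : C) (f : hom A B) (y : hom T B) :
  regular_epi f ->
  exists T' (c : hom T' T) (x : hom T' A), regular_epi c /\ f ∘ x = y ∘ c.
Proof.
  intros Hf. destruct HC as (Hlim & _ & Hstab).
  destruct (pullback_exists Hlim f y) as (P & p & q & HP).
  exists P, q, p. split; [exact (Hstab _ _ _ _ _ _ _ _ HP Hf) | apply HP].
Qed.

Lemma image_factorization (X Y : C) (f : hom X Y) :
  exists I (e : hom X I) (m : hom I Y), regular_epi e /\ m ∘ e = f /\
    forall T (u v : hom T I), m ∘ u = m ∘ v -> u = v.
Proof.
  destruct HC as (Hlim & Hcoeq & _).
  destruct (pullback_exists Hlim f f) as (P & p & q & HP).
  destruct (Hcoeq _ _ _ _ _ _ HP) as (I & e & He).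
  destruct (proj2 He _ f (proj1 HP)) as (m & Hm & _).
  assert (Hreg := coequalizer_regular_epi He).
  exists I, e, m. split; [exact Hreg | split; [exact Hm |]].
  intros T u v E.
  destruct (local_lift u Hreg) as (T1 & c1 & x & Hc1 & Hx).
  destruct (local_lift (v ∘ c1) Hreg) as (T2 & c2 & y & Hc2 & Hy).
  (* Over a common cover, [x ∘ c2] and [y] lift [u] and [v]. As [f] identifies them, they form an
     element of the kernel pair, and [e] coequalizes its legs. *)
  destruct (pullback_lift (a := x ∘ c2) (b := y) HP) as (w & Hw1 & Hw2).
  { rewrite <- Hm, <- !comp_assoc, Hy, (comp_reassoc _ Hx), !comp_assoc.
    now rewrite E. }
  apply (regular_epi_epi Hc1), (regular_epi_epi Hc2).
  rewrite <- Hx, <- Hy, <- comp_assoc, <- Hw1, <- Hw2, !comp_assoc.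
  now rewrite (proj1 He).
Qed.

Lemma regular_epi_iso_comp (A B D : C) (f : hom A B) (g : hom B D)
    (h : hom D B) :
  g ∘ h = idm D -> h ∘ g = idm B -> regular_epi f -> regular_epi (g ∘ f).
Proof.
  intros Hgh Hhg (W & s & t & Hc & Hu). exists W, s, t. split.
  - now rewrite <- !comp_assoc, Hc.
  - intros Z k Hk. destruct (Hu Z k Hk) as (l & Hl & Huniq). exists (l ∘ h).
    split.
    + rewrite <- comp_assoc, (comp_reassoc _ Hhg), comp_idl. exact Hl.
    + intros l' Hl'. rewrite (Huniq (l' ∘ g)).
      * now rewrite <- comp_assoc, Hgh, comp_idr.
      * now rewrite <- comp_assoc.
Qed.

(** The hypothesis says that [f] factors through no proper subobject of [B]. Applied to the mono
    part of the image of [f], it makes that part an isomorphism. *)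
Lemma regular_epi_local (A B : C) (f : hom A B) :
  (forall I (m : hom I B) (e : hom A I),
     (forall T (u v : hom T I), m ∘ u = m ∘ v -> u = v) -> m ∘ e = f ->
     exists s, m ∘ s = idm B) ->
  regular_epi f.
Proof.
  intros H. destruct (image_factorization f) as (I & e & m & He & Hf & Hm).
  destruct (H I m e Hm Hf) as (s & Hs). rewrite <- Hf.
  apply (regular_epi_iso_comp (h := s)); auto.
  apply Hm. now rewrite (comp_reassoc _ Hs), comp_idl, comp_idr.
Qed.

(** A subobject through which [f] factors also admits a factorization of the cover [c], so it is
    everything by descent. *)
Lemma regular_epi_of_lift (A B T : C) (f : hom A B) (c : hom T B)
    (x : hom T A) : regular_epi c -> f ∘ x = c -> regular_epi f.
Proof.
  intros Hc Hx. apply regular_epi_local. intros I m e Hm He.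
  apply (mono_descent (c := c) (w := e ∘ x)); auto.
  now rewrite comp_assoc, He, comp_idl.
Qed.

(** The image of [W] in [Y × Y]: its elements come from [W] only after passing to a cover. *)
Lemma image_relation (W Y : C) (f g : hom W Y) :
  exists R : relation Y, related R f g /\
    forall T (u v : hom T Y), related R u v ->
      exists T' (c : hom T' T) (w : hom T' W),
        regular_epi c /\ f ∘ w = u ∘ c /\ g ∘ w = v ∘ c.
Proof.
  destruct (product_exists (proj1 HC) Y Y) as (YY & y1 & y2 & HY).
  destruct (image_factorization (pairing HY f g)) as (I & e & m & He & Hf & Hm).
  assert (H1 : y1 ∘ m ∘ e = f) by now rewrite <- comp_assoc, Hf, fst_pairing.
  assert (H2 : y2 ∘ m ∘ e = g) by now rewrite <- comp_assoc, Hf, snd_pairing.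
  unshelve eexists (@Relation C Y I (y1 ∘ m) (y2 ∘ m) _).
  - intros T u v E1 E2. rewrite <- !comp_assoc in E1, E2. apply Hm.
    exact (product_ext HY E1 E2).
  - split; [now exists e |].
    intros T u v (w & <- & <-). simpl.
    destruct (local_lift w He) as (T' & c & x & Hc & Hx).
    exists T', c, x. split; auto.
    rewrite <- H1, <- H2. split; now rewrite <- (comp_assoc _ w), <- Hx, comp_assoc.
Qed.

End RegularEpi.

(** * Projections out of objects with global support *)

Section GlobalSupport.
Context (C : category) (HC : regular_category C).

Lemma product_fst_regular_epi (X A A' : C) (p : hom X A) (p' : hom X A') :
  global_support X -> is_product p p' -> regular_epi p.
Proof.
  intros (T & t & HT & Ht) H. destruct (HT A) as (tA & _).
  destruct (local_lift HC tA Ht) as (T' & c & x & Hc & _).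
  (* Global support provides an element [x] of [X] over a cover [c] of [A]; its second coordinate
     completes [c] to a lift of [c] along [p]. *)
  apply (regular_epi_of_lift HC (x := pairing H c (p' ∘ x)) Hc).
  apply fst_pairing.
Qed.

Lemma projection_regular_epi (X A : C) (p : hom X A) :
  global_support X -> product_projection p -> regular_epi p.
Proof.
  intros HX (A' & p' & [H | H]).
  - exact (product_fst_regular_epi HX H).
  - exact (product_fst_regular_epi HX (is_product_swap H)).
Qed.

Lemma projection_global_support (X A : C) (p : hom X A) :
  global_support X -> global_support A.
Proof.
  intros (T & t & HT & Ht). destruct (HT A) as (tA & _).
  exists T, tA. split; auto.
  apply (regular_epi_of_lift HC (x := p) Ht). now apply terminal_eq.
Qed.

End GlobalSupport.

(** * Images of kernel relations and their quotients *)

Section DirectImage.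
Context (C : category) (HC : regular_category C).

(* [R] is the image under [m] of the kernel relation of [p]. *)
Definition direct_image (X A Y : C) (p : hom X A) (m : hom X Y)
    (R : relation Y) : Prop :=
  (forall T (x y : hom T X), p ∘ x = p ∘ y -> related R (m ∘ x) (m ∘ y)) /\
  (forall T (u v : hom T Y), related R u v ->
     exists T' (c : hom T' T) (x y : hom T' X),
       regular_epi c /\ p ∘ x = p ∘ y /\ m ∘ x = u ∘ c /\ m ∘ y = v ∘ c).

Lemma direct_image_exists (X A Y : C) (p : hom X A) (m : hom X Y) :
  exists R, direct_image p m R.
Proof.
  destruct (pullback_exists (proj1 HC) p p) as (K & k1 & k2 & HK).
  destruct (image_relation HC (m ∘ k1) (m ∘ k2)) as (R & HR & Hloc).
  exists R. split.
  - intros T x y E. destruct (pullback_lift HK E) as (w & <- & <-).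
    rewrite !comp_assoc. now apply related_comp.
  - intros T u v H. destruct (Hloc _ _ _ H) as (T' & c & w & Hc & E1 & E2).
    exists T', c, (k1 ∘ w), (k2 ∘ w).
    rewrite !comp_assoc, (proj1 HK). auto.
Qed.

Lemma direct_image_reflexive (X A Y : C) (p : hom X A) (m : hom X Y)
    (R : relation Y) :
  regular_epi m -> direct_image p m R -> reflexive_rel R.
Proof.
  intros Hm [HR _] T y.
  destruct (local_lift HC y Hm) as (T' & c & x & Hc & Hx).
  apply (related_descent Hc). rewrite <- Hx. now apply HR.
Qed.

(* A map [h] out of [Y] coequalizes [R] iff [h ∘ m] factors through [p]. *)
Lemma direct_image_pushout (X A Y Q : C) (p : hom X A) (m : hom X Y)
    (R : relation Y) (q : hom Y Q) :
  regular_epi p -> direct_image p m R -> is_coequalizer (r1 R) (r2 R) q ->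
  exists v : hom A Q, is_pushout m p q v.
Proof.
  intros Hp [HR Hloc] Hq.
  assert (Hrel : forall T (x y : hom T Y), related R x y -> q ∘ x = q ∘ y).
  { intros T x y (w & <- & <-). now rewrite !comp_assoc, (proj1 Hq). }
  destruct (regular_epi_factor (k := q ∘ m) Hp) as (v & Hv).
  { intros T s t E. rewrite <- !comp_assoc. apply Hrel. now apply HR. }
  exists v. split; [easy |].
  intros Z h k E.
  destruct (proj2 Hq Z h) as (l & Hl & Huniq).
  - destruct (Hloc _ (r1 R) (r2 R)) as (T' & c & x & y & Hc & Exy & Ex & Ey).
    { exists (idm _). now rewrite !comp_idr. }
    apply (regular_epi_epi Hc).
    rewrite <- !comp_assoc, <- Ex, <- Ey, !comp_assoc, E, <- !comp_assoc.
    now rewrite Exy.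
  - exists l. split.
    + split; [exact Hl |]. apply (regular_epi_epi Hp).
      now rewrite <- comp_assoc, Hv, comp_assoc, Hl.
    + intros l' [Hl' _]. now apply Huniq.
Qed.

End DirectImage.

(** Element form of a connector, with [s] playing [p(e1, e2, e3)]. The two identities are stated
    along every [c], since in later use two entries coincide only after restriction. *)
Lemma connector_at (C : category) (Y : C) (R S : relation Y) T
    (e1 e2 e3 : hom T Y) :
  commuting R S -> related R e1 e2 -> related S e2 e3 ->
  exists s : hom T Y, related S e1 s /\ related R s e3 /\
    (forall T' (c : hom T' T), e2 ∘ c = e3 ∘ c -> s ∘ c = e1 ∘ c) /\
    (forall T' (c : hom T' T), e1 ∘ c = e2 ∘ c -> s ∘ c = e3 ∘ c).
Proof.
  intros (P & a & b & HP & p & H1 & H2 & H3 & H4) (w & <- & <-) (w' & E & <-).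
  destruct (pullback_lift (a := w) (b := w') HP) as (t & <- & <-); [easy |].
  exists (p ∘ t). rewrite !comp_assoc.
  split; [now apply related_comp | split; [now apply related_comp |]].
  split; intros T' c; rewrite <- !(comp_assoc _ t), ?comp_assoc.
  - intros Hc. rewrite <- comp_assoc. rewrite H3; now rewrite !comp_assoc.
  - intros Hc. rewrite <- comp_assoc. rewrite H4; now rewrite !comp_assoc.
Qed.

(** * The operation on [X] induced by a product decomposition *)

Section ProductOperation.
Context (C : category) (HC : regular_category C) (HM : maltsev C).
Context (X A1 A2 Y : C) (p1 : hom X A1) (p2 : hom X A2) (m : hom X Y).
Context (Hp : is_product p1 p2) (Hm : regular_epi m).

(** In coordinates this is [((x1, x2), (z1, z2)) ↦ (x1, z2)], the rectangular band operation of the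
    decomposition. *)
Definition mix T (x z : hom T X) : hom T X := pairing Hp (p1 ∘ x) (p2 ∘ z).

Lemma fst_mix T (x z : hom T X) : p1 ∘ mix x z = p1 ∘ x.
Proof. apply fst_pairing. Qed.

Lemma snd_mix T (x z : hom T X) : p2 ∘ mix x z = p2 ∘ z.
Proof. apply snd_pairing. Qed.

Lemma mix_comp T T' (x z : hom T X) (c : hom T' T) :
  mix x z ∘ c = mix (x ∘ c) (z ∘ c).
Proof. unfold mix. now rewrite pairing_comp, !comp_assoc. Qed.

Lemma mix_eq_r T (x z : hom T X) : p1 ∘ x = p1 ∘ z -> mix x z = z.
Proof.
  intros E. apply (product_ext Hp); now rewrite ?fst_mix, ?snd_mix.
Qed.

Lemma mix_eq_l T (x z : hom T X) : p2 ∘ x = p2 ∘ z -> mix x z = x.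
Proof.
  intros E. apply (product_ext Hp); now rewrite ?fst_mix, ?snd_mix.
Qed.

(* Difunctionality of the relation [m x = m x', m z = m z',
   m (mix x z) = m (mix x' z'), m (mix z x) = m (mix z' x')] between pairs
   [(x, x')] and pairs [(z, z')], applied to the pairs [(x, x')], [(y, y')],
   [(z, z')] with [y = mix x z] and [y' = mix x' z']. *)
Lemma mix_compat_swap T (x z x' z' : hom T X) :
  m ∘ x = m ∘ x' -> m ∘ z = m ∘ z' -> m ∘ mix x z = m ∘ mix x' z' ->
  m ∘ mix z x = m ∘ mix z' x'.
Proof.
  intros Ex Ez Ey.
  destruct (product_exists (proj1 HC) X X) as (XX & f & s & HXX).
  destruct (product_exists (proj1 HC) Y Y) as (YY & yf & ys & HYY).
  destruct (product_exists (proj1 HC) YY YY) as (Y4 & l & r & HY4).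
  pose (Phi := fun T (a b : hom T X) => pairing HY4
    (pairing HYY (m ∘ a) (m ∘ b)) (pairing HYY (m ∘ mix a b) (m ∘ mix b a))).
  assert (HPhi : forall T (a b a' b' : hom T X), Phi _ a b = Phi _ a' b' <->
    m ∘ a = m ∘ a' /\ m ∘ b = m ∘ b' /\
    m ∘ mix a b = m ∘ mix a' b' /\ m ∘ mix b a = m ∘ mix b' a').
  { intros Z a b a' b'. split.
    - intros E.
      pose proof (f_equal (fun h => yf ∘ (l ∘ h)) E) as E1.
      pose proof (f_equal (fun h => ys ∘ (l ∘ h)) E) as E2.
      pose proof (f_equal (fun h => yf ∘ (r ∘ h)) E) as E3.
      pose proof (f_equal (fun h => ys ∘ (r ∘ h)) E) as E4.
      unfold Phi in *.
      repeat rewrite ?fst_pairing, ?snd_pairing in *. auto.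
    - intros (E1 & E2 & E3 & E4). unfold Phi. now rewrite E1, E2, E3, E4. }
  assert (Phi_comp : forall T T' (a b : hom T X) (c : hom T' T),
    Phi _ a b ∘ c = Phi _ (a ∘ c) (b ∘ c)).
  { intros Z Z' a b c. unfold Phi.
    now rewrite !pairing_comp, <- !comp_assoc, !mix_comp. }
  (* The kernel pair [M] of [Phi] consists of pairs [(a, b)], [(a', b')] with the same four
     invariants; it is then read as a relation between [(a, a')] and [(b, b')]. *)
  destruct (pullback_exists (proj1 HC) (Phi _ f s) (Phi _ f s))
    as (M & k & k' & HK).
  assert (point : forall T (a b a' b' : hom T X),
    m ∘ a = m ∘ a' -> m ∘ b = m ∘ b' -> m ∘ mix a b = m ∘ mix a' b' ->
    m ∘ mix b a = m ∘ mix b' a' ->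
    exists u : hom T M, k ∘ u = pairing HXX a b /\ k' ∘ u = pairing HXX a' b').
  { intros Z a b a' b' E1 E2 E3 E4. apply (pullback_lift HK).
    rewrite !Phi_comp, !fst_pairing, !snd_pairing. now apply HPhi. }
  set (y := mix x z) in *. set (y' := mix x' z') in *.
  (* As [x] and [y] share their first coordinate, [mix x y = y] and [mix y x = x], so all four
     invariants reduce to the given equations. For [y] and [z], which share the second coordinate,
     [mix y z = y] and [mix z y = z]. *)
  destruct (point T x y x' y') as (u & Hu & Hu'); auto.
  { unfold y, y'. now rewrite !(mix_eq_r (x := x)), !(mix_eq_r (x := x'))
      by now rewrite fst_mix. }
  { unfold y, y'. now rewrite !(mix_eq_r (z := x)), !(mix_eq_r (z := x'))
      by now rewrite fst_mix. }
  destruct (point T y y y' y') as (v & Hv & Hv'); auto.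
  1-2: now rewrite !mix_eq_l.
  destruct (point T y z y' z') as (w & Hw & Hw'); auto.
  { unfold y, y'. now rewrite !(mix_eq_l (z := z)), !(mix_eq_l (z := z'))
      by now rewrite snd_mix. }
  { unfold y, y'. now rewrite !(mix_eq_l (x := z)), !(mix_eq_l (x := z'))
      by now rewrite snd_mix. }
  destruct (@maltsev_difunctional C (proj1 HC) HM _ _ _
    (pairing HXX (f ∘ k) (f ∘ k')) (pairing HXX (s ∘ k) (s ∘ k')))
    with (T := T) (u := u) (v := v) (w := w) as (t & Hi & Hj).
  - intros Z a b Ef Es.
    pose proof (f_equal (comp f) Ef) as Ef1.
    pose proof (f_equal (comp s) Ef) as Ef2.
    pose proof (f_equal (comp f) Es) as Es1.
    pose proof (f_equal (comp s) Es) as Es2.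
    rewrite !comp_assoc, ?fst_pairing, ?snd_pairing, <- !comp_assoc in *.
    apply (pullback_ext HK); now apply (product_ext HXX).
  - rewrite !pairing_comp, <- !comp_assoc, Hu, Hu', Hv, Hv'.
    now rewrite !snd_pairing.
  - rewrite !pairing_comp, <- !comp_assoc, Hw, Hw', Hv, Hv'.
    now rewrite !fst_pairing.
  (* The element [t] of [M] shows that [(x, z)] and [(x', z')] have equal invariants; the fourth one
     is the goal. *)
  - rewrite !pairing_comp, <- !comp_assoc, Hu, Hu', !fst_pairing in Hi.
    rewrite !pairing_comp, <- !comp_assoc, Hw, Hw', !snd_pairing in Hj.
    pose proof (f_equal (comp f) Hi) as Hi1.
    pose proof (f_equal (comp s) Hi) as Hi2.
    pose proof (f_equal (comp f) Hj) as Hj1.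
    pose proof (f_equal (comp s) Hj) as Hj2.
    rewrite ?fst_pairing, ?snd_pairing in *.
    pose proof (f_equal (fun h => h ∘ t) (proj1 HK)) as E. simpl in E.
    rewrite <- !comp_assoc, !Phi_comp, Hi1, Hi2, Hj1, Hj2 in E.
    now apply HPhi in E.
Qed.

Context (R S : relation Y).
Context (HR : direct_image p1 m R) (HS : direct_image p2 m S).

(* The connector sends the triple [(m x, m (mix x z), m z)] to
   [m (mix z x)]. *)
Lemma direct_images_commuting : commuting R S.
Proof.
  assert (Rrefl := direct_image_reflexive HC Hm HR).
  assert (Srefl := direct_image_reflexive HC Hm HS).
  destruct (pullback_exists (proj1 HC) (r2 R) (r1 S)) as (P & a & b & HP).
  destruct (product_exists (proj1 HC) X X) as (XX & x & z & HXX).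
  destruct (proj1 HR _ x (mix x z)) as (rho & Hrho1 & Hrho2).
  { now rewrite fst_mix. }
  destruct (proj1 HS _ (mix x z) z) as (sig & Hsig1 & Hsig2).
  { now rewrite snd_mix. }
  destruct (pullback_lift (a := rho) (b := sig) HP) as (phi & Ha & Hb).
  { now rewrite Hrho2, Hsig1. }
  assert (E1 : r1 R ∘ a ∘ phi = m ∘ x) by now rewrite <- comp_assoc, Ha.
  assert (E2 : r2 R ∘ a ∘ phi = m ∘ mix x z) by now rewrite <- comp_assoc, Ha.
  assert (E2' : r1 S ∘ b ∘ phi = m ∘ mix x z) by now rewrite <- comp_assoc, Hb.
  assert (E3 : r2 S ∘ b ∘ phi = m ∘ z) by now rewrite <- comp_assoc, Hb.
  assert (P_ext : forall T (t t' : hom T P),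
    r1 R ∘ a ∘ t = r1 R ∘ a ∘ t' -> r2 R ∘ a ∘ t = r2 R ∘ a ∘ t' ->
    r2 S ∘ b ∘ t = r2 S ∘ b ∘ t' -> t = t').
  { intros T t t' H1 H2 H3. apply (pullback_ext HP).
    - apply (@rel_mono _ _ R); now rewrite !comp_assoc.
    - apply (@rel_mono _ _ S); rewrite !comp_assoc; [|easy].
      now rewrite <- (proj1 HP). }
  (* Triples with equal last two entries are hit locally by [phi]: choose preimages [u], [v] with
     the same first coordinate, so that [mix u v = v]. The assertion [left] is the mirror image,
     with [mix u v = u]. *)
  assert (right : forall T (t : hom T P), r2 R ∘ a ∘ t = r2 S ∘ b ∘ t ->
    exists T' (c : hom T' T) (u v : hom T' X), regular_epi c /\
      p1 ∘ u = p1 ∘ v /\ phi ∘ pairing HXX u v = t ∘ c).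
  { intros T t E.
    destruct (proj2 HR _ _ _ (related_refl_at (a ∘ t)))
      as (T' & c & u & v & Hc & Huv & Hu & Hv).
    exists T', c, u, v. repeat split; auto.
    apply P_ext.
    - rewrite (comp_assoc _ phi), E1, <- comp_assoc, fst_pairing, Hu.
      now rewrite !comp_assoc.
    - rewrite (comp_assoc _ phi), E2, <- comp_assoc, mix_comp, fst_pairing,
        snd_pairing, mix_eq_r, Hv by easy.
      now rewrite !comp_assoc.
    - rewrite (comp_assoc _ phi), E3, <- comp_assoc, snd_pairing, Hv.
      now rewrite !comp_assoc, E. }
  assert (left : forall T (t : hom T P), r1 R ∘ a ∘ t = r2 R ∘ a ∘ t ->
    exists T' (c : hom T' T) (u v : hom T' X), regular_epi c /\
      p2 ∘ u = p2 ∘ v /\ phi ∘ pairing HXX u v = t ∘ c).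
  { intros T t E.
    destruct (proj2 HS _ _ _ (related_refl_at (b ∘ t)))
      as (T' & c & u & v & Hc & Huv & Hu & Hv).
    assert (Eab : r2 R ∘ a ∘ t = r1 S ∘ b ∘ t) by now rewrite (proj1 HP).
    exists T', c, u, v. repeat split; auto.
    apply P_ext.
    - rewrite (comp_assoc _ phi), E1, <- comp_assoc, fst_pairing, Hu.
      now rewrite !comp_assoc, E, Eab.
    - rewrite (comp_assoc _ phi), E2, <- comp_assoc, mix_comp, fst_pairing,
        snd_pairing, mix_eq_l, Hu by easy.
      now rewrite !comp_assoc, Eab.
    - rewrite (comp_assoc _ phi), E3, <- comp_assoc, snd_pairing, Hv.
      now rewrite !comp_assoc. }
  (* A subobject of [P] through which [phi] factors contains both kinds of degenerate triples by
     descent, and these generate [P]. *)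
  assert (Hphi : regular_epi phi).
  { apply (regular_epi_local HC). intros I i e Hi He.
    apply (maltsev_triples_generated (proj1 HC) HM Rrefl Srefl HP Hi).
    - intros T t E. destruct (right _ _ E) as (T' & c & u & v & Hc & _ & Et).
      apply (mono_descent (w := e ∘ pairing HXX u v) Hi Hc).
      now rewrite comp_assoc, He.
    - intros T t E. destruct (left _ _ E) as (T' & c & u & v & Hc & _ & Et).
      apply (mono_descent (w := e ∘ pairing HXX u v) Hi Hc).
      now rewrite comp_assoc, He. }
  (* The value [m (mix z x)] depends only on the triple, by [mix_compat_swap], so it descends along
     [phi]. *)
  destruct (regular_epi_factor (k := m ∘ mix z x) Hphi) as (q & Hq).
  { intros T s t E.
    rewrite <- !comp_assoc, !mix_comp. apply mix_compat_swap.
    - now rewrite !comp_assoc, <- E1, <- !(comp_assoc _ phi), E.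
    - now rewrite !comp_assoc, <- E3, <- !(comp_assoc _ phi), E.
    - now rewrite <- !mix_comp, !comp_assoc, <- E2, <- !(comp_assoc _ phi), E. }
  exists P, a, b. split; [exact HP |]. exists q. repeat split.
  - apply (related_descent Hphi). rewrite E1, Hq. apply (proj1 HS).
    now rewrite snd_mix.
  - apply (related_descent Hphi). rewrite E3, Hq. apply (proj1 HR).
    now rewrite fst_mix.
  (* Locally the triple is [phi (u, v)] with [p1 u = p1 v]; then [mix v u = u], and the connector
     returns [m u], the first entry. *)
  - intros T t E. destruct (right _ _ E) as (T' & c & u & v & Hc & Huv & Et).
    apply (regular_epi_epi Hc).
    rewrite <- !(comp_assoc _ t), <- Et, !(comp_assoc _ phi), Hq, E1.
    rewrite <- !comp_assoc, mix_comp, fst_pairing, snd_pairing.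
    now rewrite mix_eq_r.
  - intros T t E. destruct (left _ _ E) as (T' & c & u & v & Hc & Huv & Et).
    apply (regular_epi_epi Hc).
    rewrite <- !(comp_assoc _ t), <- Et, !(comp_assoc _ phi), Hq, E3.
    rewrite <- !comp_assoc, mix_comp, fst_pairing, snd_pairing.
    now rewrite mix_eq_l.
Qed.

Context (Y' : C) (n : hom X Y') (Hmn : is_product m n) (HX : centerless X).

(* The relation [E] below is central: [m u'] and [m w] are linked through
   [m (mix u' w)] by [R] and then [S], so two applications of the connector of
   [R] and [S] give one with the total relation. *)
Lemma direct_images_disjoint T (e e' : hom T Y) :
  related R e e' -> related S e e' -> e = e'.
Proof.
  assert (Rrefl := direct_image_reflexive HC Hm HR).
  assert (Srefl := direct_image_reflexive HC Hm HS).
  destruct (proj2 HM _ _ Rrefl) as (_ & Rsym & Rtrans).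
  destruct (proj2 HM _ _ Srefl) as (_ & Ssym & Strans).
  destruct (relation_preimage (proj1 HC) m R) as (R' & HR').
  destruct (relation_preimage (proj1 HC) m S) as (S' & HS').
  destruct (kernel_relation (proj1 HC) n) as (K & HK).
  destruct (intersection_exists (proj1 HC) R' S') as (RS & HRS).
  destruct (intersection_exists (proj1 HC) RS K) as (E & HE').
  assert (HE : forall T (u v : hom T X), related E u v <->
    related R (m ∘ u) (m ∘ v) /\ related S (m ∘ u) (m ∘ v) /\ n ∘ u = n ∘ v).
  { intros Z u v. rewrite (HE' _ _ _), (HRS _ _ _), HR', HS'.
    rewrite (related_kernel _ _ HK). tauto. }
  assert (Eeq : equivalence_rel E).
  { apply (proj2 HM). intros Z x. apply HE. auto. }
  destruct (product_exists (proj1 HC) X X) as (XX & x & z & HXX).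
  pose (N := @Relation C X XX x z (@product_ext C _ _ _ _ _ HXX)).
  assert (central : commuting E N).
  { destruct (product_exists (proj1 HC) (rob E) X) as (P & g & w & HP).
    (* The generic triple is [u E u' N w]. The element [t] satisfies [m t R m u'] and
       [m t S m w]. *)
    pose (u := r1 E ∘ g). pose (u' := r2 E ∘ g). pose (t := mix u' w).
    destruct (proj1 (HE _ u u')) as (HuR & HuS & Hun).
    { apply related_refl_at. }
    assert (HtR : related R (m ∘ t) (m ∘ u')).
    { apply (proj1 HR). apply fst_mix. }
    assert (HtS : related S (m ∘ t) (m ∘ w)).
    { apply (proj1 HS). apply snd_mix. }
    (* The connector is applied first to [(m t, m u', m u)], giving [s1], then to [(s1, m t, m w)],
       giving [s2]. *)
    destruct (connector_at direct_images_commuting HtR (Ssym _ _ _ HuS))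
      as (s1 & H1S & H1R & H1r & H1l).
    assert (H1R' : related R s1 (m ∘ t)) by eauto.
    destruct (connector_at direct_images_commuting H1R' HtS)
      as (s2 & H2S & H2R & H2r & H2l).
    exists P, g, (pairing HXX u' w). split.
    - split; [now simpl; rewrite fst_pairing |].
      intros Z a b Hab. exists (pairing HP a (z ∘ b)). split.
      + split; [apply fst_pairing |]. apply (product_ext HXX).
        * rewrite comp_assoc, fst_pairing. unfold u'.
          rewrite <- comp_assoc, fst_pairing. exact Hab.
        * rewrite comp_assoc, snd_pairing, snd_pairing. reflexivity.
      + intros v [Hv1 Hv2]. apply (product_ext HP).
        * now rewrite fst_pairing.
        * now rewrite snd_pairing, <- Hv2, comp_assoc, snd_pairing.
    (* The component along [n] is that of [w], as [E] demands. If [u' = w], then [t] equals both, so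
       [s2 = s1 = m u]; if [u = u'], then [s1 = m t], so [s2 = m w]. *)
    - exists (pairing Hmn s2 (n ∘ w)).
      unfold is_connector, N. simpl. rewrite snd_pairing. repeat split.
      + exists (pairing HXX u (pairing Hmn s2 (n ∘ w))). simpl.
        now rewrite fst_pairing, snd_pairing.
      + apply HE. rewrite fst_pairing, snd_pairing. split; [easy | split; [|easy]].
        eauto.
      + intros Z c Hc. fold u' in Hc. fold u.
        apply (product_ext Hmn);
          rewrite (comp_assoc _ (pairing _ _ _)), ?fst_pairing, ?snd_pairing.
        * assert (Et : t ∘ c = w ∘ c).
          { unfold t. rewrite mix_comp. now apply mix_eq_r; rewrite Hc. }
          rewrite H2r, H1l.
          -- now rewrite comp_assoc.
          -- rewrite <- !comp_assoc. now rewrite Et, Hc.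
          -- rewrite <- !comp_assoc. now rewrite Et.
        * now rewrite <- comp_assoc, <- Hc, !comp_assoc, Hun.
      + intros Z c Hc. fold u u' in Hc.
        apply (product_ext Hmn);
          rewrite (comp_assoc _ (pairing _ _ _)), ?fst_pairing, ?snd_pairing.
        * rewrite H2l; [now rewrite comp_assoc |].
          apply H1r. rewrite <- !comp_assoc. now rewrite Hc.
        * now rewrite comp_assoc. }
  destruct (HX Eeq (N := N) HXX central) as [Hle _].
  intros HeR HeS.
  destruct (local_lift HC e Hm) as (T' & c & v & Hc & Hv).
  apply (regular_epi_epi Hc).
  (* Replacing the [Y]-component of the lift [v] of [e] by [e'] gives an element [E]-related to [v];
     as [E] is diagonal, the two have the same [Y]-component. *)
  destruct (proj2 (HE _ v (pairing Hmn (e' ∘ c) (n ∘ v)))) as (k & Hk1 & Hk2).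
  { rewrite fst_pairing, snd_pairing, Hv. repeat split; auto using related_comp. }
  assert (Eq : r1 E = r2 E) by now apply related_diagonal.
  rewrite <- Hv, <- Hk1, Eq, Hk2. apply fst_pairing.
Qed.

Context (HPE : pre_exact C) (Hp1 : regular_epi p1) (Hp2 : regular_epi p2).

Lemma quotient_product_pushouts :
  exists Q1 Q2 (q1 : hom Y Q1) (q2 : hom Y Q2) (v1 : hom A1 Q1) (v2 : hom A2 Q2),
    is_product q1 q2 /\ is_pushout m p1 q1 v1 /\ is_pushout m p2 q2 v2.
Proof.
  assert (Req := proj2 HM _ _ (direct_image_reflexive HC Hm HR)).
  assert (Seq := proj2 HM _ _ (direct_image_reflexive HC Hm HS)).
  destruct HPE as (_ & Hcoeq & Hclosure).
  destruct (Hcoeq _ _ Req) as (Q1 & q1 & Hq1).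
  destruct (Hcoeq _ _ Seq) as (Q2 & q2 & Hq2).
  destruct (direct_image_pushout Hp1 HR Hq1) as (v1 & Hv1).
  destruct (direct_image_pushout Hp2 HS Hq2) as (v2 & Hv2).
  exists Q1, Q2, q1, q2, v1, v2. split; [| auto].
  destruct (kernel_relation (proj1 HC) q1) as (K1 & HK1).
  destruct (kernel_relation (proj1 HC) q2) as (K2 & HK2).
  assert (Hinter : is_intersection R S (diagonal Y)).
  { intros T u v. rewrite related_diagonal. split.
    - intros ->. split; [exact (proj1 Req _ v) | exact (proj1 Seq _ v)].
    - intros []. now apply direct_images_disjoint. }
  assert (HK : is_intersection K1 K2 (diagonal Y)).
  { apply (Hclosure _ _ _ _ _ _ _ Req Seq Hinter).
    - now exists Q1, q1.
    - now exists Q2, q2.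
    (* The diagonal is its own effective closure: the identity is its quotient, with the diagonal as
       kernel pair. *)
    - exists Y, (idm Y). split.
      + split; [easy |]. intros Z h _. exists h. split; [apply comp_idr |].
        intros h' <-. now rewrite comp_idr.
      + split; [easy |]. intros Z u v E. rewrite !comp_idl in E. subst v.
        exists u. simpl. split; [now rewrite comp_idl |].
        intros w [<- _]. now rewrite comp_idl. }
  assert (jmono : forall T (u v : hom T Y),
    q1 ∘ u = q1 ∘ v -> q2 ∘ u = q2 ∘ v -> u = v).
  { intros T u v E1 E2. apply related_diagonal, HK.
    now rewrite (related_kernel _ _ HK1), (related_kernel _ _ HK2). }
  intros Z y1 y2.
  destruct (local_lift HC y1 (coequalizer_regular_epi Hq1))
    as (T1 & c1 & e1 & Hc1 & He1).
  destruct (local_lift HC (y2 ∘ c1) (coequalizer_regular_epi Hq2))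
    as (T2 & c2 & e2 & Hc2 & He2).
  destruct (local_lift HC (e1 ∘ c2) Hm) as (T3 & c3 & x & Hc3 & Hx).
  destruct (local_lift HC (e2 ∘ c3) Hm) as (T4 & c4 & z & Hc4 & Hz).
  (* Each [qi ∘ m] factors through [pi], so [y] has the image of [x] in [Q1] and the image of [z] in
     [Q2]. *)
  pose (y := m ∘ mix (x ∘ c4) z).
  assert (Hy1 : q1 ∘ y = y1 ∘ c1 ∘ c2 ∘ c3 ∘ c4).
  { unfold y. rewrite comp_assoc, (proj1 Hv1), <- comp_assoc, fst_mix.
    rewrite comp_assoc, <- (proj1 Hv1), <- comp_assoc, (comp_reassoc _ Hx).
    now rewrite !comp_assoc, He1. }
  assert (Hy2 : q2 ∘ y = y2 ∘ c1 ∘ c2 ∘ c3 ∘ c4).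
  { unfold y. rewrite comp_assoc, (proj1 Hv2), <- comp_assoc, snd_mix.
    rewrite comp_assoc, <- (proj1 Hv2), <- comp_assoc, Hz.
    now rewrite !comp_assoc, He2. }
  destruct (product_exists (proj1 HC) Q1 Q2) as (QQ & pi1 & pi2 & HQ).
  pose (i := pairing HQ q1 q2).
  assert (Hi : forall T (u v : hom T Y), i ∘ u = i ∘ v -> u = v).
  { intros T u v E. unfold i in E. rewrite !pairing_comp in E.
    apply jmono.
    - pose proof (f_equal (comp pi1) E) as E'. now rewrite !fst_pairing in E'.
    - pose proof (f_equal (comp pi2) E) as E'. now rewrite !snd_pairing in E'. }
  (* The local preimage [y] descends along the four covers one at a time, because [i] is mono. *)
  destruct (mono_descent (y := pairing HQ y1 y2 ∘ c1 ∘ c2 ∘ c3) (w := y) Hi Hc4)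
    as (y3 & Hy3).
  { unfold i. now rewrite !pairing_comp, Hy1, Hy2. }
  destruct (mono_descent (y := pairing HQ y1 y2 ∘ c1 ∘ c2) (w := y3) Hi Hc3)
    as (y4 & Hy4); [easy |].
  destruct (mono_descent (y := pairing HQ y1 y2 ∘ c1) (w := y4) Hi Hc2)
    as (y5 & Hy5); [easy |].
  destruct (mono_descent (y := pairing HQ y1 y2) (w := y5) Hi Hc1)
    as (y6 & Hy6); [easy |].
  exists y6. unfold i in Hy6. split.
  - split.
    + pose proof (f_equal (comp pi1) Hy6) as E'.
      now rewrite comp_assoc, !fst_pairing in E'.
    + pose proof (f_equal (comp pi2) Hy6) as E'.
      now rewrite comp_assoc, !snd_pairing in E'.
  - intros y' [E1 E2].
    pose proof (f_equal (comp pi1) Hy6) as E1'.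
    pose proof (f_equal (comp pi2) Hy6) as E2'.
    rewrite comp_assoc, !fst_pairing in E1'.
    rewrite comp_assoc, !snd_pairing in E2'.
    apply jmono; now rewrite ?E1, ?E2.
Qed.

End ProductOperation.

(** * Invariance of pushouts and products under isomorphism *)

Section Pushouts.
Context (C : category).

Lemma product_projection_iso (Y Q Q' : C) (q : hom Y Q) (f : hom Q Q')
    (g : hom Q' Q) :
  g ∘ f = idm Q -> f ∘ g = idm Q' -> product_projection q ->
  product_projection (f ∘ q).
Proof.
  intros Hgf Hfg (A' & q' & H). exists A', q'.
  assert (post : forall q'' : hom Y A',
    is_product q q'' -> is_product (f ∘ q) q'').
  { intros q'' Hq Z a b. exists (pairing Hq (g ∘ a) b). split.
    - split; [| apply snd_pairing].
      now rewrite <- comp_assoc, fst_pairing, comp_assoc, Hfg, comp_idl.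
    - intros u [Ea <-]. apply (product_ext Hq).
      + rewrite fst_pairing, <- Ea, <- comp_assoc.
        now rewrite (comp_reassoc _ Hgf), comp_idl.
      + apply snd_pairing. }
  destruct H as [H | H]; [left; auto | right].
  apply is_product_swap, post, is_product_swap, H.
Qed.

Lemma pushout_iso (X A B Q Q' : C) (f : hom X A) (g : hom X B) (u : hom A Q)
    (v : hom B Q) (u' : hom A Q') (v' : hom B Q') :
  is_pushout f g u v -> is_pushout f g u' v' ->
  exists (h : hom Q Q') (k : hom Q' Q),
    k ∘ h = idm Q /\ h ∘ k = idm Q' /\ h ∘ u = u' /\ h ∘ v = v'.
Proof.
  intros [E H] [E' H'].
  destruct (H _ u' v' E') as (h & (Hu & Hv) & _).
  destruct (H' _ u v E) as (k & (Ku & Kv) & _).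
  destruct (H _ u v E) as (l & _ & Hl).
  destruct (H' _ u' v' E') as (l' & _ & Hl').
  exists h, k. repeat split; auto.
  - rewrite <- (Hl (idm Q)), <- (Hl (k ∘ h)); auto.
    + split; rewrite <- comp_assoc; congruence.
    + split; apply comp_idl.
  - rewrite <- (Hl' (idm Q')), <- (Hl' (h ∘ k)); auto.
    + split; rewrite <- comp_assoc; congruence.
    + split; apply comp_idl.
Qed.

Lemma pushout_swap (X A B Q : C) (f : hom X A) (g : hom X B) (u : hom A Q)
    (v : hom B Q) : is_pushout f g u v -> is_pushout g f v u.
Proof.
  intros [E H]. split; [easy |]. intros Z b a Hba.
  destruct (H Z a b) as (h & [] & Hh); [easy |].
  exists h. split; [easy |]. intros h' []. now apply Hh.
Qed.

Lemma is_product_iso (Y B1 B2 B1' B2' : C) (q1 : hom Y B1) (q2 : hom Y B2)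
    (h1 : hom B1 B1') (k1 : hom B1' B1) (h2 : hom B2 B2') (k2 : hom B2' B2) :
  k1 ∘ h1 = idm B1 -> h1 ∘ k1 = idm B1' ->
  k2 ∘ h2 = idm B2 -> h2 ∘ k2 = idm B2' ->
  is_product q1 q2 -> is_product (h1 ∘ q1) (h2 ∘ q2).
Proof.
  intros E1 E1' E2 E2' H Z a b. exists (pairing H (k1 ∘ a) (k2 ∘ b)). split.
  - rewrite <- !comp_assoc, fst_pairing, snd_pairing, !comp_assoc, E1', E2'.
    split; apply comp_idl.
  - intros u [<- <-].
    rewrite <- !comp_assoc, (comp_reassoc _ E1), (comp_reassoc _ E2), !comp_idl.
    apply (product_ext H); now rewrite ?fst_pairing, ?snd_pairing.
Qed.

End Pushouts.

(** * Pushouts of product projections and coextensivity *)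

Lemma centerless_quotient_pushouts (C : category) (X A1 A2 Y : C)
    (p1 : hom X A1) (p2 : hom X A2) (m : hom X Y) :
  pre_exact C -> maltsev C -> centerless X -> global_support X ->
  is_product p1 p2 -> product_projection m ->
  exists Q1 Q2 (q1 : hom Y Q1) (q2 : hom Y Q2) (v1 : hom A1 Q1) (v2 : hom A2 Q2),
    is_product q1 q2 /\ is_pushout m p1 q1 v1 /\ is_pushout m p2 q2 v2.
Proof.
  intros HP HM HX HG Hp Hm.
  pose proof (proj1 HP) as HC.
  destruct (direct_image_exists HC p1 m) as (R & HR).
  destruct (direct_image_exists HC p2 m) as (S & HS).
  pose proof (projection_regular_epi HC HG Hm) as Hreg.
  pose proof (product_fst_regular_epi HC HG Hp) as Hp1.
  pose proof (product_fst_regular_epi HC HG (is_product_swap Hp)) as Hp2.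
  destruct Hm as (Y' & n & [Hmn | Hnm]).
  - exact (quotient_product_pushouts HC HM Hp Hreg HR HS Hmn HX HP Hp1 Hp2).
  - apply is_product_swap in Hnm.
    exact (quotient_product_pushouts HC HM Hp Hreg HR HS Hnm HX HP Hp1 Hp2).
Qed.

Lemma projection_pushout (C : category) (X Y A : C) (m : hom X Y) (p : hom X A) :
  pre_exact C -> maltsev C -> centerless X -> global_support X ->
  product_projection m -> product_projection p ->
  exists Q (u : hom Y Q) (v : hom A Q),
    is_pushout m p u v /\ product_projection u.
Proof.
  intros HP HM HX HG Hm (A' & p' & H).
  assert (Hp : is_product p p') by (destruct H; auto using is_product_swap).
  destruct (centerless_quotient_pushouts HP HM HX HG Hp Hm)
    as (Q & Q' & q & q' & v & v' & Hq & Hpush & _).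
  exists Q, q, v. split; [exact Hpush | exists Q', q'; now left].
Qed.

(** If [q1] identifies [s] and [t], they lift locally to elements of [X] with a common first
    coordinate [a]. Since [h ∘ m = k ∘ p1], both [h s] and [h t] are then [k a], so [h] factors
    through [q1]. *)
Lemma product_square_pushout (C : category) (X A1 A2 Y B1 B2 : C)
    (p1 : hom X A1) (p2 : hom X A2) (q1 : hom Y B1) (q2 : hom Y B2)
    (m : hom X Y) (m1 : hom A1 B1) (m2 : hom A2 B2) :
  regular_category C -> global_support X -> is_product p1 p2 ->
  is_product q1 q2 ->
  regular_epi m1 -> regular_epi m2 ->
  q1 ∘ m = m1 ∘ p1 -> q2 ∘ m = m2 ∘ p2 -> is_pushout m p1 q1 m1.
Proof.
  intros HC HG Hp Hq H1 H2 E1 E2. split; [exact E1 |].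
  intros Z h k E.
  assert (Hq1 : regular_epi q1).
  { exact (product_fst_regular_epi HC (projection_global_support HC m HG) Hq). }
  assert (Hp1 := product_fst_regular_epi HC HG Hp).
  destruct (regular_epi_factor (k := h) Hq1) as (l & Hl).
  - intros T s t Est.
    destruct (local_lift HC (q1 ∘ s) H1) as (T1 & c1 & a & Hc1 & Ha).
    destruct (local_lift HC (q2 ∘ s ∘ c1) H2) as (T2 & c2 & b & Hc2 & Hb).
    destruct (local_lift HC (q2 ∘ t ∘ c1 ∘ c2) H2) as (T3 & c3 & b' & Hc3 & Hb').
    apply (regular_epi_epi Hc1), (regular_epi_epi Hc2), (regular_epi_epi Hc3).
    assert (Es : s ∘ c1 ∘ c2 ∘ c3 = m ∘ pairing Hp (a ∘ c2 ∘ c3) (b ∘ c3)).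
    { apply (product_ext Hq); rewrite !(comp_assoc _ m).
      - rewrite E1, <- (comp_assoc _ p1), fst_pairing.
        now rewrite !comp_assoc, Ha.
      - rewrite E2, <- (comp_assoc _ p2), snd_pairing.
        now rewrite !comp_assoc, Hb. }
    assert (Et : t ∘ c1 ∘ c2 ∘ c3 = m ∘ pairing Hp (a ∘ c2 ∘ c3) b').
    { apply (product_ext Hq); rewrite !(comp_assoc _ m).
      - rewrite E1, <- (comp_assoc _ p1), fst_pairing.
        now rewrite !comp_assoc, Ha, Est.
      - rewrite E2, <- (comp_assoc _ p2), snd_pairing.
        now rewrite !comp_assoc, Hb'. }
    transitivity (h ∘ (s ∘ c1 ∘ c2 ∘ c3)); [now rewrite !comp_assoc |].
    transitivity (h ∘ (t ∘ c1 ∘ c2 ∘ c3)); [| now rewrite !comp_assoc].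
    rewrite Es, Et, !(comp_assoc h), E, <- !comp_assoc.
    now rewrite !fst_pairing.
  - exists l. split.
    + split; [exact Hl |]. apply (regular_epi_epi Hp1).
      now rewrite <- comp_assoc, <- E1, comp_assoc, Hl.
    + intros l' [Hl' _]. apply (regular_epi_epi Hq1). now rewrite Hl.
Qed.

Theorem proposition6p2 (C : category) (X : C) :
  pre_exact C -> maltsev C -> centerless X -> global_support X ->
  projection_coextensive X.
Proof.
  intros HP HM HX HG. split.
  - intros Y A m p Hm Hp.
    destruct (projection_pushout HP HM HX HG Hm Hp) as (Q & u & v & Hpush & Hu).
    (* Exchanging [m] and [p] gives a pushout whose other leg is a projection; the comparison
       isomorphism transfers this to [v]. *)
    destruct (projection_pushout HP HM HX HG Hp Hm)
      as (Q' & v' & u' & Hpush' & Hv').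
    apply pushout_swap in Hpush'.
    destruct (pushout_iso Hpush' Hpush) as (h & k & Hkh & Hhk & _ & <-).
    exists Q, u, (h ∘ v'). split; [exact Hpush | split; [exact Hu |]].
    exact (product_projection_iso Hkh Hhk Hv').
  - intros A1 A2 Y B1 B2 p1 p2 q1 q2 m m1 m2 Hp Hm Hm1 Hm2 E1 E2.
    pose proof (proj1 HP) as HC. split.
    + intros Hq.
      pose proof (projection_regular_epi HC
        (projection_global_support HC p1 HG) Hm1) as R1.
      pose proof (projection_regular_epi HC
        (projection_global_support HC p2 HG) Hm2) as R2.
      split; (split; [| split; [| assumption]]).
      * exact (product_square_pushout HC HG Hp Hq R1 R2 E1 E2).
      * exists B2, q2. now left.
      * exact (product_square_pushout HC HG (is_product_swap Hp)
          (is_product_swap Hq) R2 R1 E2 E1).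
      * exists B1, q1. now right.
    (* The quotient pushouts already have a product as bottom row, and comparison isomorphisms carry
       it to [q1], [q2]. *)
    + intros [[Hpush1 _] [Hpush2 _]].
      destruct (centerless_quotient_pushouts HP HM HX HG Hp Hm)
        as (Q1 & Q2 & r1 & r2 & v1 & v2 & Hr & Hv1 & Hv2).
      destruct (pushout_iso Hv1 Hpush1) as (h1 & k1 & K1 & H1 & <- & _).
      destruct (pushout_iso Hv2 Hpush2) as (h2 & k2 & K2 & H2 & <- & _).
      exact (is_product_iso K1 H1 K2 H2 Hr).
Qed.
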